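(* Let $f:\mathbb{R}\times\mathbb{R}^n\to\mathbb{R}^n$ satisfy, for some $L_f>0$, $$\|f(t_1,x_1)-f(t_2,x_2)\|\le L_f|t_1-t_2|+L_f\|x_1-x_2\|\quad\text{for all } t_1,t_2\in\mathbb{R},\ x_1,x_2\in\mathbb{R}^n,$$ and, for some $\alpha>0$, $$\langle f(t,x_1)-f(t,x_2),x_1-x_2\rangle\ge\alpha\|x_1-x_2\|^2\quad\text{for all } t\in\mathbb{R},\ x_1,x_2\in\mathbb{R}^n.$$ Assume that, for every $t\in\mathbb{R}$, the set $C(t)\subset\mathbb{R}^n$ is nonempty, closed and convex, that for some $L_C>0$ one has $d_H(C(t_1),C(t_2))\le L_C|t_1-t_2|$ for all $t_1,t_2\in\mathbb{R}$, and that $C$ is globally bounded, i.e. there is $M>0$ such that $\|c\|\le M$ for all $c\in C(t)$ and all $t\in\mathbb{R}$. Let $x_0$ be the unique absolutely continuous solution defined on the entire $\mathbb{R}$ of the sweeping process $$-\dot x(t)\in N_{C(t)}(x(t))+f(t,x(t)).$$ If the function $t\mapsto f(t,x)$ is almost periodic for each $x\in\mathbb{R}^n$ and the set-valued function $t\mapsto C(t)$ is almost periodic, then $x_0$ is almost periodic.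
   Context: For a closed convex set $C\subset\mathbb{R}^n$, the outward normal cone is $N_C(x)=\{\xi\in\mathbb{R}^n:\langle\xi,c-x\rangle\le 0\text{ for all }c\in C\}$ if $x\in C$ and $N_C(x)=\emptyset$ if $x\notin C$. The Hausdorff distance between closed sets is $d_H(C_1,C_2)=\max\{\sup_{x\in C_2}\mathrm{dist}(x,C_1),\sup_{x\in C_1}\mathrm{dist}(x,C_2)\}$ with $\mathrm{dist}(x,C)=\inf\{\|x-c\|:c\in C\}$. A solution of the sweeping process on an interval $I\subseteq\mathbb{R}$ is a function $x:I\to\mathbb{R}^n$, absolutely continuous on every compact subinterval of $I$, with $x(t)\in C(t)$ for all $t\in I$, that satisfies the inclusion for almost every $t\in I$. Under the stated hypotheses a solution on the entire $\mathbb{R}$ exists and is unique. A continuous function $\phi$ from $\mathbb{R}$ to the metric space of closed bounded nonempty subsets of $\mathbb{R}^n$ with metric $d_H$ is almost periodic if for every $\varepsilon>0$ there is $p(\varepsilon)>0$ such that every interval of $\mathbb{R}$ of length $p(\varepsilon)$ contains a point $s$ with $d_H(\phi(t+s),\phi(t))<\varepsilon$ for all $t\in\mathbb{R}$. For a continuous $\phi:\mathbb{R}\to\mathbb{R}^n$ the definition is the same with $\|\phi(t+s)-\phi(t)\|$ in place of $d_H(\phi(t+s),\phi(t))$. *)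

(* Defs.v *)
From HB Require Import structures.
From mathcomp Require Import all_boot all_order all_algebra.
From mathcomp Require Import all_classical all_reals all_analysis.

Set Implicit Arguments.
Unset Strict Implicit.
Unset Printing Implicit Defensive.

Import Order.TTheory GRing.Theory Num.Theory.
Import numFieldNormedType.Exports.

Local Open Scope classical_set_scope.
Local Open Scope ring_scope.

(* R^n is 'rV[R]_n. The library norm `|u| on matrices is the sup norm, so the
   Euclidean structure is defined here; both norms induce the library topology,
   hence closed, continuous, bounded_set and derivative are used as they are. *)
Definition dotp (R : realType) (n : nat) (u v : 'rV[R]_n) : R :=
  \sum_(i < n) u 0 i * v 0 i.

Definition enorm (R : realType) (n : nat) (u : 'rV[R]_n) : R :=
  Num.sqrt (dotp u u).

Definition normal_cone (R : realType) (n : nat) (C : set 'rV[R]_n)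
    (x : 'rV[R]_n) : set 'rV[R]_n :=
  [set xi | C x /\ forall c, C c -> dotp xi (c - x) <= 0].

Definition set_dist (R : realType) (n : nat) (x : 'rV[R]_n)
    (C : set 'rV[R]_n) : \bar R :=
  ereal_inf [set (enorm (x - c))%:E | c in C].

Definition hausdorff_dist (R : realType) (n : nat)
    (C1 C2 : set 'rV[R]_n) : \bar R :=
  maxe (ereal_sup [set set_dist x C1 | x in C2])
       (ereal_sup [set set_dist x C2 | x in C1]).

(* The finitely many open subintervals ]u i, v i[ of [a, b] are pairwise
   disjoint; degenerate ones (u i = v i) are empty and contribute 0. *)
Definition abs_continuous (R : realType) (n : nat) (a b : R)
    (x : R -> 'rV[R]_n) : Prop :=
  forall e : R, 0 < e -> exists2 d : R, 0 < d &
    forall (m : nat) (u v : 'I_m -> R),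
      (forall i, a <= u i /\ u i <= v i /\ v i <= b) ->
      trivIset setT (fun i => [set` `]u i, v i[]) ->
      \sum_(i < m) (v i - u i) < d ->
      \sum_(i < m) enorm (x (v i) - x (u i)) < e.

(* Solution on I of - x'(t) \in N_{C(t)}(x(t)) + f(t, x(t)). A function on I is
   represented by a total function; its values outside I only affect the
   derivative at the endpoints of I, a null set. *)
Definition sweeping_solution (R : realType) (n : nat) (I : interval R)
    (f : R -> 'rV[R]_n -> 'rV[R]_n) (C : R -> set 'rV[R]_n)
    (x : R -> 'rV[R]_n) : Prop :=
  [/\ forall a b : R, a <= b -> `[a, b] `<=` [set` I] -> abs_continuous a b x,
      forall t : R, t \in I -> C t (x t) &
      {ae @lebesgue_measure R, forall t : R, t \in I ->
         derivable x t 1 /\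
         [set xi + f t (x t) | xi in normal_cone (C t) (x t)] (- 'D_1 x t)}].

(* Every interval of length p contains a point of a given set iff every open
   interval ]a, a + p[ does. *)
Definition has_almost_periods (R : realType) (T : Type) (d : T -> T -> \bar R)
    (phi : R -> T) : Prop :=
  forall e : R, 0 < e -> exists2 p : R, 0 < p &
    forall a : R, exists2 s : R, s \in `]a, a + p[ &
      forall t : R, (d (phi (t + s)%R) (phi t) < e%:E)%E.

Definition almost_periodic (R : realType) (n : nat) (phi : R -> 'rV[R]_n)
    : Prop :=
  continuous phi /\
  has_almost_periods (fun u v => (enorm (u - v))%:E) phi.

Definition almost_periodic_set (R : realType) (n : nat)
    (phi : R -> set 'rV[R]_n) : Prop :=
  [/\ forall t : R, [/\ closed (phi t), bounded_set (phi t) & phi t !=set0],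
      forall (t e : R), 0 < e ->
        \forall u \near t, (hausdorff_dist (phi u) (phi t) < e%:E)%E &
      has_almost_periods (@hausdorff_dist R n) phi].

(* Main.v *)
(* Let s be a common almost period, up to de, of C and of f(., y) for all y in
   the ball containing the sets C t. Then t |-> x0 (t + s) solves a sweeping
   process close to the original one, and V t = |x0 (t + s) - x0 t|^2 satisfies
   V' <= - 2 alpha V + O(de) almost everywhere: the monotonicity of f gives the
   damping, and the normal components, which are bounded because C moves at
   speed at most LC, contribute O(de) since each solution is de-close to the set
   of the other one. V being bounded on the whole line, V = O(de) everywhere.
   Common almost periods of finitely many data are differences of their
   individual ones, selected by the pigeonhole principle; equi-Lipschitz
   continuity of f and a finite net take care of all y in the ball. *)

Require Import Defs.
From HB Require Import structures.
From mathcomp Require Import all_boot all_order all_algebra.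
From mathcomp Require Import all_classical all_reals all_analysis.
From mathcomp Require Import measurable_realfun ring lra.

Set Implicit Arguments.
Unset Strict Implicit.
Unset Printing Implicit Defensive.

Import Order.TTheory GRing.Theory Num.Theory.
Import numFieldNormedType.Exports.

Local Open Scope classical_set_scope.
Local Open Scope ring_scope.

(** * Euclidean norm and derivatives *)

Section Euclidean.
Context {R : realType} {n : nat}.
Implicit Types (u v w : 'rV[R]_n) (a : R).

Lemma dotpC u v : dotp u v = dotp v u.
Proof. by apply: eq_bigr => i _; rewrite mulrC. Qed.

Lemma dotpDl u v w : dotp (u + v) w = dotp u w + dotp v w.
Proof.
by rewrite /dotp -big_split; apply: eq_bigr => i _; rewrite mxE mulrDl.
Qed.

Lemma dotpZl a u v : dotp (a *: u) v = a * dotp u v.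
Proof.
by rewrite /dotp mulr_sumr; apply: eq_bigr => i _; rewrite mxE mulrA.
Qed.

Lemma dotpDr u v w : dotp w (u + v) = dotp w u + dotp w v.
Proof. by rewrite dotpC dotpDl !(dotpC w). Qed.

Lemma dotpZr a u v : dotp v (a *: u) = a * dotp v u.
Proof. by rewrite dotpC dotpZl dotpC. Qed.

Lemma dotpNl u v : dotp (- u) v = - dotp u v.
Proof. by rewrite -scaleN1r dotpZl mulN1r. Qed.

Lemma dotpNr u v : dotp v (- u) = - dotp v u.
Proof. by rewrite dotpC dotpNl dotpC. Qed.

Definition dotpE := (dotpDl, dotpDr, dotpNl, dotpNr, dotpZl, dotpZr).

Lemma dotp_ge0 u : 0 <= dotp u u.
Proof. by apply: sumr_ge0 => i _; rewrite -expr2 sqr_ge0. Qed.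

Lemma enorm_ge0 u : 0 <= enorm u.
Proof. exact: sqrtr_ge0. Qed.

Lemma enorm_sqr u : enorm u ^+ 2 = dotp u u.
Proof. by rewrite sqr_sqrtr// dotp_ge0. Qed.

Lemma enormN u : enorm (- u) = enorm u.
Proof. by rewrite /enorm !dotpE opprK. Qed.

Lemma enormB u v : enorm (u - v) = enorm (v - u).
Proof. by rewrite -enormN opprB. Qed.

Lemma enorm0 : enorm (0 : 'rV[R]_n) = 0.
Proof. by rewrite /enorm /dotp big1 ?sqrtr0// => i _; rewrite mxE mul0r. Qed.

Lemma coord_le_enorm u i : `|u 0 i| <= enorm u.
Proof.
rewrite -sqrtr_sqr ler_sqrt ?dotp_ge0// /dotp (bigD1 i)//= -expr2 lerDl.
by apply: sumr_ge0 => j _; rewrite -expr2 sqr_ge0.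
Qed.

Lemma norm_le_enorm u : `|u| <= enorm u.
Proof.
rewrite [X in X <= _]mx_normrE; apply/bigmax_leP; split; first exact: enorm_ge0.
by move=> [i j] _ /=; rewrite ord1 coord_le_enorm.
Qed.

(** Bounding every coordinate by the sup norm gives a factor of the square root of [n]; the cruder
    [n] follows from [n <= n ^ 2] and keeps later constants free of roots. *)
Lemma enorm_le_norm u : enorm u <= n%:R * `|u|.
Proof.
rewrite -(ler_pXn2r (n := 2))// ?nnegrE ?enorm_ge0 ?mulr_ge0//.
rewrite enorm_sqr (@le_trans _ _ (\sum_(i < n) `|u| ^+ 2))//.
  apply: ler_sum => i _; rewrite -expr2 -real_normK ?num_real//.
  rewrite ler_pXn2r ?nnegrE// [leRHS]mx_normrE.
  exact: (le_bigmax _ (fun ij => `|u ij.1 ij.2|) (ord0, i)).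
rewrite sumr_const card_ord exprMn -[leLHS]mulr_natl.
have nn : (n%:R : R) <= n%:R ^+ 2.
  by rewrite -natrX ler_nat; case: (n) => // k; rewrite expnS leq_pmulr.
by apply: ler_wpM2r nn; exact: sqr_ge0.
Qed.

Lemma dotp_le_enorm u v : dotp u v <= enorm u * enorm v.
Proof.
have zero w w' : enorm w = 0 -> dotp w w' = 0.
  move=> w0; rewrite /dotp big1// => i _.
  have := coord_le_enorm w i; rewrite w0 normr_le0 => /eqP->.
  by rewrite mul0r.
have [u0|un0] := eqVneq (enorm u) 0; first by rewrite zero// u0 mul0r.
have [v0|vn0] := eqVneq (enorm v) 0; first by rewrite dotpC zero// v0 mulr0.
have up : 0 < enorm u by rewrite lt_neqAle eq_sym un0 enorm_ge0.
have vp : 0 < enorm v by rewrite lt_neqAle eq_sym vn0 enorm_ge0.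
(* This square expands to [2 * enorm u * enorm v] times the defect
   [enorm u * enorm v - dotp u v]. *)
have := dotp_ge0 (enorm v *: u - enorm u *: v).
rewrite !dotpE (dotpC v u) -!enorm_sqr => h.
by rewrite -subr_ge0 -(pmulr_rge0 _ (mulr_gt0 up vp)); lra.
Qed.

Lemma enormD u v : enorm (u + v) <= enorm u + enorm v.
Proof.
rewrite -(ler_pXn2r (n := 2))// ?nnegrE ?addr_ge0 ?enorm_ge0//.
rewrite enorm_sqr !dotpE (dotpC v u) -!enorm_sqr.
by have := dotp_le_enorm u v; lra.
Qed.

Lemma enorm_triangle w u v : enorm (u - v) <= enorm (u - w) + enorm (w - v).
Proof. by rewrite -[u - v](subrKA w) enormD. Qed.

End Euclidean.

Section Derivatives.
Context {R : realType}.

(** Straddle lemma: the increments from [t] to [u] and to [v] differ from the linear ones by at most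
    [e] times the respective lengths, and since [t] lies in between these errors add up to
    [e * (v - u)]. *)
Lemma derive_straddle (g : R -> R) (t k e : R) :
  derivable g t 1 -> 'D_1 g t <= k -> 0 < e ->
  exists2 r, 0 < r & forall u v, t - r < u -> u <= t -> t <= v -> v < t + r ->
    g v - g u <= (k + e) * (v - u).
Proof.
move=> gd gk e0.
have /cvgrPdist_lt/(_ e e0) :
    h^-1 *: (g (h *: 1 + t) - g t) @[h --> 0^'] --> 'D_1 g t.
  exact: gd.
rewrite near_withinE => /nbhs_ballP[r /= r0 hr].
have one h : `|h| < r -> `|g (h + t) - g t - h * 'D_1 g t| <= e * `|h|.
  have [->|h0] := eqVneq h 0; first
    by rewrite add0r subrr mul0r subrr !normr0 mulr0.
  move=> hlt; have := hr h; rewrite /ball/= sub0r normrN => /(_ hlt h0).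
  rewrite [h *: 1]mulr1 [_ *: _]mulrC.
  move=> /ltW; rewrite -(ler_pM2r (_ : 0 < `|h|)) ?normr_gt0// -normrM.
  by rewrite mulrBl divfK// distrC [_ * h]mulrC.
exists r => // u v ru ut tv vr.
have hu : `|u - t| < r by rewrite ler0_norm; lra.
have hv : `|v - t| < r by rewrite ger0_norm; lra.
have := one _ hu; have := one _ hv; rewrite !subrK.
rewrite (ger0_norm (_ : 0 <= v - t)) ?subr_ge0//.
rewrite (ler0_norm (_ : u - t <= 0)) ?subr_le0//.
have : 0 <= (k - 'D_1 g t) * (v - u) by rewrite mulr_ge0//; lra.
by rewrite !ler_norml => ? /andP[_ ?] /andP[? _]; lra.
Qed.

Lemma derivable_dotp n (x y : R -> 'rV[R]_n) t :
  derivable x t 1 -> derivable y t 1 ->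
  is_derive t 1 (fun u => dotp (x u) (y u))
    (dotp (x t) ('D_1 y t) + dotp (y t) ('D_1 x t)).
Proof.
move=> /[dup] xd /derivable_mxP xd' /[dup] yd /derivable_mxP yd'.
have -> : (fun u => dotp (x u) (y u)) =
    \sum_(i < n) ((fun u => x u 0 i) * (fun u => y u 0 i)).
  by apply/funext => u; rewrite fct_sumE.
rewrite /dotp -big_split; apply: is_derive_sum => i.
have xi : is_derive t 1 (fun u => x u 0 i) ('D_1 x t 0 i).
  by rewrite (derive_mx xd) mxE; exact/derivableP/(xd' 0 i).
have yi : is_derive t 1 (fun u => y u 0 i) ('D_1 y t 0 i).
  by rewrite (derive_mx yd) mxE; exact/derivableP/(yd' 0 i).
exact: is_deriveM.
Qed.

End Derivatives.
(** * Increments of absolutely continuous functions *)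

Section AbsoluteContinuity.
Context {R : realType}.
Implicit Types (w : R -> R -> R) (a b : R) (U : set R) (l : seq (R * R)).

(** Absolute continuity phrased for a function [w] of intervals, so that increments of a curve,
    increments of its translate and plain lengths can be added and rescaled. *)
Definition small_on_short a b w := forall e, 0 < e -> exists2 d, 0 < d &
  forall (m : nat) (u v : 'I_m -> R),
    (forall i, a <= u i /\ u i <= v i /\ v i <= b) ->
    trivIset setT (fun i => [set` `]u i, v i[]) ->
    \sum_(i < m) (v i - u i) < d -> \sum_(i < m) w (u i) (v i) < e.

Lemma small_on_shortD a b w1 w2 : small_on_short a b w1 ->
  small_on_short a b w2 -> small_on_short a b (fun u v => w1 u v + w2 u v).
Proof.
move=> h1 h2 e e0; have e20 : 0 < e / 2 by lra.
have [d1 d10 {}h1] := h1 _ e20; have [d2 d20 {}h2] := h2 _ e20.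
exists (Num.min d1 d2); first by rewrite lt_min d10.
move=> m u v uv tuv; rewrite lt_min => /andP[s1 s2].
by rewrite big_split /= (splitr e) ltrD ?h1 ?h2.
Qed.

Lemma small_on_shortZ a b w k : 0 < k -> small_on_short a b w ->
  small_on_short a b (fun u v => k * w u v).
Proof.
move=> k0 h e e0; have [d d0 {}h] := h _ (divr_gt0 e0 k0).
exists d => // m u v uv tuv sd; rewrite -mulr_sumr mulrC -ltr_pdivlMr//.
exact: h.
Qed.

Lemma small_on_short_length a b : small_on_short a b (fun u v => v - u).
Proof. by move=> e e0; exists e. Qed.

Local Notation o := ((0, 0) : R * R).

(* l lists consecutive intervals from right to left, all between a and c, with
   interiors inside U. *)
Fixpoint chain U a l c : Prop := if l is (u, v) :: l' then
  [/\ u <= v, v <= c, [set` `]u, v[] `<=` U & chain U a l' u] else a <= c.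

Lemma chain_le U a l c : chain U a l c -> a <= c.
Proof.
elim: l c => [|[u v] l ih] c //= [uv vc _ /ih au].
exact: le_trans au (le_trans uv vc).
Qed.

Lemma chain_widen U a l c c' : c <= c' -> chain U a l c -> chain U a l c'.
Proof.
case: l => [|[u v] l] /= cc; first by move=> /le_trans; exact.
by case=> uv vc UU ch; split=> //; exact: le_trans cc.
Qed.

Lemma chain_nth U a l c : chain U a l c -> forall i, (i < size l)%N ->
  [/\ a <= (nth o l i).1, (nth o l i).1 <= (nth o l i).2,
    (nth o l i).2 <= c
    & [set` `](nth o l i).1, (nth o l i).2[] `<=` U].
Proof.
elim: l c => [|[u v] l ih] c //= [uv vc uvU ch] [_|i /(ih _ ch)[? ? iu ?]] /=.
  by split=> //; exact: chain_le ch.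
by split=> //; exact: le_trans iu (le_trans uv vc).
Qed.

Lemma chain_sorted U a l c : chain U a l c -> forall i j,
  (i < j)%N -> (j < size l)%N -> (nth o l j).2 <= (nth o l i).1.
Proof.
elim: l c => [|[u v] l ih] c //= [uv vc uvU ch] [|i] [|j]//=;
  last exact: ih ch i j.
by move=> _ /(chain_nth ch)[].
Qed.

Lemma chain_trivIset U a l c : chain U a l c -> trivIset setT
  (fun i : 'I_(size l) => [set` `](nth o l i).1, (nth o l i).2[]).
Proof.
move=> ch i j _ _ [x /= []]; rewrite !in_itv/= => /andP[i1 i2] /andP[j1 j2].
apply/val_inj; case: (ltngtP i j) => // ij.
  have := chain_sorted ch ij (ltn_ord j) => h.
  by have := lt_trans (lt_le_trans j2 h) i1; rewrite ltxx.
have := chain_sorted ch ij (ltn_ord i) => h.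
by have := lt_trans (lt_le_trans i2 h) j1; rewrite ltxx.
Qed.

(** The open intervals of a chain are disjoint, so their total length is the measure of their union,
    which lies in [U]. *)
Lemma chain_length U a l c d : measurable U ->
  (lebesgue_measure U < d%:E)%E -> chain U a l c ->
  \sum_(i < size l) ((nth o l i).2 - (nth o l i).1) < d.
Proof.
move=> mU Ud ch; rewrite -lte_fin; apply: le_lt_trans Ud.
pose F (i : 'I_(size l)) : set R :=
  [set` `](nth o l i).1, (nth o l i).2[].
have mF i : measurable (F i) by exact: measurable_itv.
have FE : \sum_(i < size l) ((nth o l i).2 - (nth o l i).1)%:E =
    lebesgue_measure (\big[setU/set0]_(i < size l) F i) :> \bar R.
  rewrite measure_bigsetU_ord//; last exact: chain_trivIset ch.
  apply: eq_bigr => i _; rewrite /F [RHS]lebesgue_measure_itv/= lte_fin.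
  case: ltP => // h; have [_ h' _ _] := chain_nth ch (ltn_ord i).
  by rewrite (@le_anti _ _ (nth o l i).1 (nth o l i).2) ?h ?h'// subrr.
rewrite -sumEFin FE; apply: le_measure; rewrite ?inE//.
  by apply: bigsetU_measurable => i _; exact: mF.
elim/big_ind: _ => // [A B ? ?|i _]; first by rewrite subUset.
by case: (chain_nth ch (ltn_ord i)).
Qed.

Lemma chain_small U a l c b d e w : measurable U -> c <= b ->
  (lebesgue_measure U < d%:E)%E ->
  (forall (m : nat) (u v : 'I_m -> R),
    (forall i, a <= u i /\ u i <= v i /\ v i <= b) ->
    trivIset setT (fun i => [set` `]u i, v i[]) ->
    \sum_(i < m) (v i - u i) < d -> \sum_(i < m) w (u i) (v i) < e) ->
  chain U a l c -> \sum_(i <- l) w i.1 i.2 < e.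
Proof.
move=> mU cb Ud small ch; rewrite (big_nth o) big_mkord.
apply: small; [|exact: chain_trivIset ch|exact: chain_length ch].
move=> i; have [? ? ? _] := chain_nth ch (ltn_ord i).
by split=> //; split=> //; apply: le_trans cb.
Qed.

(* Cousin's lemma in disguise: the supremum of the points c reachable from a by
   steps that either have slope at most e or lie inside U is b itself. *)
Lemma chain_increment_le (g : R -> R) w U a b e : 0 < e -> a <= b -> open U ->
  (forall u v, a <= u -> u <= v -> v <= b -> g v - g u <= w u v) ->
  (forall t, a <= t <= b -> ~ U t -> exists2 r, 0 < r & forall u v,
     t - r < u -> u <= t -> t <= v -> v < t + r -> g v - g u <= e * (v - u)) ->
  exists2 l, chain U a l b & g b - g a <= e * (b - a) + \sum_(i <- l) w i.1 i.2.
Proof.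
move=> e0 ab oU gw good.
pose P c := exists2 l, chain U a l c &
  g c - g a <= e * (c - a) + \sum_(i <- l) w i.1 i.2.
pose S : set R := [set c | a <= c <= b /\ P c].
have Sa : S a.
  by split; [rewrite lexx ab|exists [::] => //=; rewrite big_nil; lra].
have Sb : has_ubound S by exists b => c [/andP[]].
have supS : has_sup S by split=> //; exists a.
set s := sup S.
have as_ : a <= s by apply: ub_le_sup.
have sb : s <= b by apply: ge_sup; [exists a|move=> c [/andP[]]].
(* It is enough to carry [P] across [s] within a window of radius [r]. If [s] is in [U] the new
   interval joins the chain; otherwise the slope bound at [s] absorbs it. *)
suff step r : 0 < r -> (forall c c', s - r < c -> c <= s -> s <= c' ->
    c' < s + r -> a <= c -> c' <= b -> P c -> P c') -> s = b /\ P b.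
  have [Us|nUs] := pselect (U s).
    have [r /= r0 rU] : exists2 r, 0 < r & ball s r `<=` U.
      by have /nbhs_ballP[r r0 ?] := oU _ Us; exists r.
    case: (step r r0) => // c c' rc cs sc' cr' ac cb' [l ch gc].
    exists ((c, c') :: l) => /=.
      split=> //; first exact: le_trans sc'.
      move=> x /=; rewrite in_itv/= => /andP[cx xc']; apply: rU.
      by rewrite /ball/= ltr_distlC; lra.
    have := gw c c' ac (le_trans cs sc') cb'.
    have : 0 <= e * (c' - c).
      by rewrite mulr_ge0 ?subr_ge0 ?(ltW e0) ?(le_trans cs).
    by rewrite big_cons/=; lra.
  have [|r r0 hr] := good s _ nUs; first by rewrite as_ sb.
  case: (step r r0) => // c c' rc cs sc' cr' ac cb' [l ch gc].
  exists l; first by apply: chain_widen ch; lra.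
  by have := hr c c' rc cs sc' cr'; lra.
move=> r0 ext.
have [c [/andP[ac cb] Pc] rc] := sup_adherent r0 supS.
have cs : c <= s by apply: ub_le_sup => //; split=> //; rewrite ac cb.
(* A point of the window strictly beyond [s] unless capped by [b]; as [c'] cannot exceed the
   supremum, the cap must be active. *)
pose c' := Num.min b (s + r / 2).
have c'b : c' <= b by rewrite ge_min lexx.
have sc' : s <= c' by rewrite le_min sb; lra.
have c'r : c' < s + r by rewrite gt_min; apply/orP; right; lra.
have Pc' : P c' by apply: (ext c c').
have c's : c' <= s.
  by apply: ub_le_sup => //; split=> //; rewrite c'b (le_trans as_ sc').
have c'E : c' = b.
  by move: c's; rewrite /c' /Num.min; case: ltP => // _; lra.
by split; [apply/le_anti; rewrite sb -c'E c's|rewrite -c'E].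
Qed.

Lemma negligible_open_cover (N : set R) (d : R) : 0 < d ->
  lebesgue_measure.-negligible N ->
  exists U : set R, [/\ open U, N `<=` U & (lebesgue_measure U < d%:E)%E].
Proof.
move=> d0 [B [mB B0 NB]].
have B0' : @lebesgue_measure R B = 0%E := B0.
have Boo : (@lebesgue_measure R B < +oo)%E by rewrite B0'.
have [U [oU BU UB]] := lebesgue_regularity_outer mB Boo d0.
exists U; split=> //; first exact: subset_trans BU.
have : (@lebesgue_measure R U <=
    @lebesgue_measure R (U `\` B) + @lebesgue_measure R B)%E.
  rewrite -{1}(setDKU BU); apply: measureU2 => //.
  by apply: measurableD => //; exact: open_measurable.
by rewrite B0' adde0 => /le_lt_trans; apply.
Qed.

(** Stands in for integrating a derivative bounded by [k] almost everywhere. The exceptional set is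
    covered by an open set so small that chains inside it contribute less than [e]; the remaining
    steps obey the slope bound. *)
Lemma ac_increment_le (g : R -> R) w (N : set R) a b k : a <= b ->
  small_on_short a b w ->
  (forall u v, a <= u -> u <= v -> v <= b -> g v - g u <= w u v) ->
  lebesgue_measure.-negligible N ->
  (forall t e, a <= t <= b -> ~ N t -> 0 < e -> exists2 r, 0 < r & forall u v,
     t - r < u -> u <= t -> t <= v -> v < t + r ->
     g v - g u <= (k + e) * (v - u)) ->
  g b - g a <= k * (b - a).
Proof.
move=> ab sw gw N0 good.
(* Subtracting the slope [k] from [g] adds [- k * (v - u)] to an increment; the positive [k']
   dominates [- k] whatever the sign of [k]. *)
pose k' := `|k| + 1.
have k'0 : 0 < k' by rewrite ltr_wpDl.
have sw' := small_on_shortD sw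
  (small_on_shortZ k'0 (small_on_short_length a b)).
suff main e : 0 < e -> g b - g a - k * (b - a) <= e * (b - a + 1).
  apply/ler_addgt0Pl => e e0; have := main (e / (b - a + 1)).
  rewrite divfK; last by rewrite lt0r_neq0//; lra.
  by rewrite divr_gt0//; [move/(_ isT); lra|lra].
move=> e0; have [d d0 small] := sw' _ e0.
have [U [oU NU Ud]] := negligible_open_cover d0 N0.
pose h t := g t - k * t.
have [||l ch hl] := @chain_increment_le h (fun u v => w u v + k' * (v - u))
  U a b e e0 ab oU.
- move=> u v au uv vb; have := gw u v au uv vb.
  rewrite /h; have : - k * (v - u) <= k' * (v - u).
    rewrite ler_wpM2r ?subr_ge0// /k'.
    by have := ler_norm (- k); rewrite normrN; lra.
  lra.
- move=> t tab nUt; have [|//|r r0 hr] := good t e tab; first by move/NU.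
  exists r => // u v h1 h2 h3 h4.
  by have := hr u v h1 h2 h3 h4; rewrite /h; lra.
have := @chain_small U a l b b d e (fun u v => w u v + k' * (v - u))
  (open_measurable oU) (lexx b) Ud small ch.
by move: hl; rewrite /h; lra.
Qed.

(** The pushforward of Lebesgue measure under a translation agrees with it on half-open intervals,
    hence everywhere by uniqueness. *)
Lemma negligible_shift (s : R) (N : set R) : lebesgue_measure.-negligible N ->
  lebesgue_measure.-negligible [set t | N (t + s)].
Proof.
move=> [B [mB B0 NB]].
have ms : measurable_fun setT (fun t : R => t + s).
  by apply: measurable_funD => //; exact: measurable_cst.
exists [set t | B (t + s)]; split; last by move=> t /NB.
  by rewrite -[X in measurable X]setTI; exact: ms.
pose mu := pushforward (@lebesgue_measure R)
  (fun t : R => t + s : measurableTypeR R).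
rewrite -B0 [RHS](@lebesgue_measure_unique _ mu) => // X [[x y] _ <-] /=.
rewrite /mu /pushforward/= (_ : _ @^-1` _ = `]x - s, y - s]%classic).
  rewrite !lebesgue_measure_itv/= !lte_fin ltrD2r -!EFinB; case: ifP => // _.
  by rewrite opprB addrA subrK.
by apply/seteqP; split=> t /=; rewrite !in_itv/=; lra.
Qed.

End AbsoluteContinuity.
(** * Common almost periods *)

Section PeriodSystems.
Context {R : realType}.
Implicit Types E : R -> R -> Prop.

(* E e s reads "s is an e-almost period". *)
Definition period_system E :=
  [/\ forall e e' s s', E e s -> E e' s' -> E (e + e') (s - s'),
    forall e, 0 < e -> exists2 h, 0 < h & forall s, `|s| < h -> E e s &
    forall e, 0 < e -> exists2 p, 0 < p &
      forall a, exists2 s, a < s < a + p & E e s].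

(** Zero is an almost period for every positive tolerance; subtracting it from [s] spends the
    surplus [e' - e]. *)
Lemma period_system_weaken E e e' s : period_system E -> e < e' ->
  E e s -> E e' s.
Proof.
move=> [diff small _] ee' Es.
have [h h0 Eh] := small (e' - e) (ltac:(lra)).
have E0 : E (e' - e) 0 by apply: Eh; rewrite normr0.
by have := diff _ _ _ _ Es E0; rewrite subr0 addrC subrK.
Qed.

(** Pigeonhole: the range of [d] is cut into finitely many cells of width [eta], one representative
    is kept for each occupied cell, and [B] dominates [h] on these. The induction adds one cell at a
    time. *)
Lemma bounded_representatives (T : Type) (d h : T -> R) (lo hi eta : R) :
  0 < eta -> (forall a, lo <= d a < hi) ->
  exists B, forall a, exists a0, `|h a0| <= B /\ `|d a - d a0| < eta.
Proof.
move=> eta0 dlohi.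
have cells (m : nat) : exists B, forall a, d a < lo + m%:R * eta ->
    exists a0, `|h a0| <= B /\ `|d a - d a0| < eta.
  elim: m => [|m [B hB]].
    by exists 0 => a; have := dlohi a; rewrite mul0r; lra.
  have [[b bm]|nob] :=
    pselect (exists b, lo + m%:R * eta <= d b < lo + m.+1%:R * eta).
    exists (Num.max B `|h b|) => a am.
    have [/hB[a0 [ha0 da0]]|ma] := ltP (d a) (lo + m%:R * eta).
      by exists a0; rewrite le_max ha0.
    exists b; rewrite le_max lexx orbT; split=> //.
    by rewrite ltr_distl; move: bm am; rewrite -[m.+1]addn1 natrD; lra.
  exists B => a am; apply: hB; rewrite ltNge; apply/negP => ma.
  by apply: nob; exists a; rewrite ma.
have [B hB] := cells (Num.truncn ((hi - lo) / eta)).+1.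
exists B => a; apply: hB; rewrite -ltrBlDl -ltr_pdivrMr//.
apply: le_lt_trans (truncnS_gt _).
by rewrite ler_pM2r ?invr_gt0//; have := dlohi a; lra.
Qed.

(* Differences s1 a - s1 a0 of almost periods of the first system are almost
   periods of the second as soon as s1 - s2 takes nearly the same value at a
   and a0; finitely many a0 suffice for all a. *)
Lemma period_systemI E1 E2 : period_system E1 -> period_system E2 ->
  period_system (fun e s => E1 e s /\ E2 e s).
Proof.
move=> ps1 ps2; have [diff1 small1 dense1] := ps1.
have [diff2 small2 dense2] := ps2; split.
- by move=> e e' s s' [? ?] [? ?]; split; [exact: diff1|exact: diff2].
- move=> e e0; have [h1 h10 E1h] := small1 _ e0.
  have [h2 h20 E2h] := small2 _ e0.
  exists (Num.min h1 h2); first by rewrite lt_min h10.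
  by move=> s; rewrite lt_min => /andP[/E1h ? /E2h ?].
move=> e e0; have e80 : 0 < e / 8 by lra.
have [p1 p10 dns1] := dense1 _ e80.
have /choice[s1 s1P] a : exists s, a < s < a + p1 /\ E1 (e / 8) s.
  by have [s ? ?] := dns1 a; exists s.
have [p2 p20 dns2] := dense2 _ e80.
have /choice[s2 s2P] a : exists s, a < s < a + p2 /\ E2 (e / 8) s.
  by have [s ? ?] := dns2 a; exists s.
have [h h0 E2h] := small2 _ e80.
(* [s1 a] and [s2 a] both exceed [a], by less than [p1] and [p2], which confines their difference to
   the range from [- p2] to [p1]. *)
have [|B hB] := @bounded_representatives R (fun a => s1 a - s2 a) s1
  (- p2) p1 h h0.
  by move=> a; have [? _] := s1P a; have [? _] := s2P a; lra.
have B0 : 0 <= B by have [a0 [+ _]] := hB 0; exact: le_trans.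
(* Selecting at [a + B] and then subtracting a number between [- B] and [B] lands between [a] and
   [a + p1 + B + B]. *)
exists (p1 + B + B) => [|a]; first by lra.
have [a0 [a0B da0]] := hB (a + B).
exists (s1 (a + B) - s1 a0).
  by have [? _] := s1P (a + B); move: a0B; rewrite ler_norml; lra.
split.
  apply: (period_system_weaken ps1 _ (diff1 _ _ _ _ (s1P _).2 (s1P _).2)); lra.
(* The difference of the [s2] values is corrected by a shift shorter than [h], itself an almost
   period; the tolerances add up to three eighths of [e]. *)
have E2d := diff2 _ _ _ _ (s2P (a + B)).2 (s2P a0).2.
have := diff2 _ _ _ _ E2d
  (E2h (- (s1 (a + B) - s2 (a + B) - (s1 a0 - s2 a0))) _).
rewrite normrN => /(_ da0);
rewrite (_ : _ - _ - - _ = s1 (a + B) - s1 a0); last by ring.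
by apply: period_system_weaken => //; lra.
Qed.

Lemma period_system_seq (T : eqType) (E : T -> R -> R -> Prop) (l : seq T) :
  (forall x, period_system (E x)) ->
  period_system (fun e s => forall x, x \in l -> E x e s).
Proof.
move=> psE; elim: l => [|y l ih].
  split=> //; first by exists 1.
  by move=> e _; exists 1 => // a; exists (a + 1 / 2); [lra|].
rewrite (_ : (fun _ => _) =
  fun e s => E y e s /\ forall x, x \in l -> E x e s).
  exact: period_systemI.
apply/funext => e; apply/funext => s; apply/propext; split.
  by move=> h; split=> [|x xl]; apply: h; rewrite inE ?eqxx ?xl ?orbT.
by move=> [hy hl] x; rewrite inE => /predU1P[->|/hl].
Qed.

Lemma enorm_ball_net n (M e : R) : 0 < e -> exists l : seq 'rV[R]_n,
  forall x, enorm x <= M -> exists2 y, y \in l & enorm (x - y) < e.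
Proof.
move=> e0; pose A := [set x : 'rV[R]_n |
  forall i, `[(- M)%R, M]%classic (x ord0 i)].
have cA : compact A.
  apply: (@rV_compact _ n (fun=> `[(- M)%R, M]%classic)) => i.
  exact: segment_compact.
(* Sup-norm balls of this radius have Euclidean radius at most [e], by the factor [n] between the
   norms; [n.+1] also covers dimension zero. *)
have r0 : 0 < e / n.+1%:R by rewrite divr_gt0.
have := cA; rewrite compact_cover.
move=> /(_ _ setT (fun y => ball y (e / n.+1%:R))).
case=> [y _|x _|D _ AD].
- exact: ball_open.
- by exists x => //; exact: ballxx.
exists (finmap.enum_fset D) => x xM; have [|y /= yD xy] := AD x.
  move=> i /=; rewrite in_itv/= -ler_norml.
  exact: le_trans (coord_le_enorm _ _) xM.
exists y => //; rewrite enormB; apply: le_lt_trans (enorm_le_norm _) _.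
move: xy; rewrite -ball_normE /= ltr_pdivlMr// mulrC; apply: le_lt_trans.
by apply: ler_wpM2r => //; rewrite ler_nat.
Qed.

(** One side of the Hausdorff distance with explicit nearby points: real-valued, and composable by
    the triangle inequality. *)
Definition excess_lt n (e : R) (A B : set 'rV[R]_n) :=
  forall c, A c -> exists2 c', B c' & enorm (c - c') < e.

Lemma excess_lt_trans n e e' (A B D : set 'rV[R]_n) :
  excess_lt e A B -> excess_lt e' B D -> excess_lt (e + e') A D.
Proof.
move=> AB BD c /AB[c' /BD[c'' Dc'' h'] h]; exists c'' => //.
exact: le_lt_trans (enorm_triangle c' _ _) (ltrD h h').
Qed.

Lemma hausdorff_excess n (e : R) (A B : set 'rV[R]_n) :
  (hausdorff_dist A B < e%:E)%E -> excess_lt e A B /\ excess_lt e B A.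
Proof.
have set_dist_lt x D : (set_dist x D < e%:E)%E ->
    exists2 c, D c & enorm (x - c) < e.
  by move=> /ereal_inf_lt[_ [c Dc <-]]; rewrite lte_fin; exists c.
rewrite /hausdorff_dist gt_max => /andP[hB hA]; split=> c cA.
  by apply: set_dist_lt; apply: le_lt_trans hA; apply: ereal_sup_ubound; exists c.
by apply: set_dist_lt; apply: le_lt_trans hB; apply: ereal_sup_ubound; exists c.
Qed.

Lemma fun_period_system n (phi : R -> 'rV[R]_n) (L : R) : 0 < L ->
  (forall t1 t2, enorm (phi t1 - phi t2) <= L * `|t1 - t2|) ->
  almost_periodic phi ->
  period_system (fun e s => forall t, enorm (phi (t + s) - phi t) < e).
Proof.
move=> L0 lip [_ ap]; split.
- move=> e e' s s' h h' t; apply: le_lt_trans (enorm_triangle (phi (t - s')) _ _) _.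
  apply: ltrD; first by have := h (t - s'); rewrite addrAC addrA.
  by have := h' (t - s'); rewrite subrK enormB.
- move=> e e0; exists (e / L) => [|s sL t]; first exact: divr_gt0.
  by apply: le_lt_trans (lip _ _) _; rewrite addrAC subrr add0r mulrC -ltr_pdivlMr.
- by move=> e /ap[p p0 h]; exists p.
Qed.

Lemma set_period_system n (phi : R -> set 'rV[R]_n) (L : R) : 0 < L ->
  (forall t1 t2, (hausdorff_dist (phi t1) (phi t2) <= (L * `|t1 - t2|)%:E)%E) ->
  almost_periodic_set phi ->
  period_system (fun e s => forall t,
    excess_lt e (phi (t + s)) (phi t) /\ excess_lt e (phi t) (phi (t + s))).
Proof.
move=> L0 lip [_ _ ap]; split.
- move=> e e' s s' h h' t; have [h1 h2] := h (t - s').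
  have [h3 h4] := h' (t - s'); rewrite subrK in h3 h4.
  rewrite addrAC -addrA in h1 h2.
  by split; [exact: excess_lt_trans h4|rewrite addrC; exact: excess_lt_trans h2].
- move=> e e0; exists (e / L) => [|s sL t]; first exact: divr_gt0.
  apply: hausdorff_excess; apply: le_lt_trans (lip _ _) _.
  by rewrite lte_fin addrAC subrr add0r mulrC -ltr_pdivlMr.
- move=> e /ap[p p0 h]; exists p => // a; have [s] := h a.
  by rewrite in_itv => /= sa hs; exists s => // t; exact: hausdorff_excess.
Qed.

End PeriodSystems.
(** * Solutions of the sweeping process *)

Section SweepingProcess.
Context {R : realType} {n : nat}.
Implicit Types (x : R -> 'rV[R]_n) (C : R -> set 'rV[R]_n).

(* Moving from x t to x u costs at most the displacement of C, which bounds
   <xi, x'> from below by -|xi| LC; the inclusion x' = - xi - y turns this into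
   a bound on xi. *)
Lemma normal_component_bound C (LC : R) x t (xi y : 'rV[R]_n) :
  0 <= LC ->
  (forall t1 t2, (hausdorff_dist (C t1) (C t2) <= (LC * `|t1 - t2|)%:E)%E) ->
  (forall u, C u (x u)) -> derivable x t 1 -> normal_cone (C t) (x t) xi ->
  xi + y = - 'D_1 x t -> enorm xi <= LC + enorm y.
Proof.
move=> LC0 Clip xC xd [_ xi_normal] inclusion.
have incr u : dotp xi (x u) - dotp xi (x t) <= enorm xi * LC * `|u - t|.
  apply/ler_addgt0Pr => e e0.
  (* Extracting a nearby point of [C t] requires a strict bound, hence this slack; the [+ 1] keeps
     the denominator positive when [xi] vanishes. *)
  have e'0 : 0 < e / (enorm xi + 1) by rewrite divr_gt0// ltr_wpDl ?enorm_ge0.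
  have [|/(_ _ (xC u))[c Cc xc] _] :=
      @hausdorff_excess _ _ (LC * `|u - t| + e / (enorm xi + 1)) (C u) (C t).
    by apply: le_lt_trans (Clip _ _) _; rewrite lte_fin ltrDl.
  have h1 := xi_normal _ Cc; have h2 := dotp_le_enorm xi (x u - c).
  have h3 : enorm xi * enorm (x u - c) <=
      enorm xi * (LC * `|u - t| + e / (enorm xi + 1)).
    by rewrite ler_wpM2l ?enorm_ge0// ltW.
  have h4 : enorm xi * (e / (enorm xi + 1)) <= e.
    have xi1 : 0 < enorm xi + 1 by rewrite ltr_wpDl ?enorm_ge0.
    by rewrite mulrA ler_pdivrMr//; lra.
  by move: h1 h2; rewrite !dotpE; lra.
have cd : derivable (cst xi : R -> 'rV[R]_n) t 1 by exact: derivable_cst.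
have [gd gD] := derivable_dotp cd xd.
(* [incr] is an upper bound on increments, so it is applied at the earlier time [t - r / 2], where
   it bounds the slope from below. *)
have lower : - (enorm xi * LC) <= dotp xi ('D_1 x t).
  apply/ler_addgt0Pr => e e0.
  have gk : 'D_1 (fun u => dotp xi (x u)) t <= dotp xi ('D_1 x t).
    rewrite gD derive_cst /dotp -big_split ler_sum//= => i _.
    by rewrite mxE mulr0 addr0.
  have [r r0 hr] := derive_straddle gd gk e0.
  have r20 : 0 < r / 2 by rewrite divr_gt0.
  have r2r : r / 2 < r by rewrite ltr_pdivrMr// ltr_pMr// ltr1n.
  have := hr (t - r / 2) t; rewrite ltrD2l ltrN2 r2r lexx ltrDl r0 gerBl ltW//.
  have := incr (t - r / 2); rewrite addrAC subrr add0r normrN gtr0_norm//.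
  rewrite subKr => h1 /(_ isT isT isT isT) h2.
  rewrite -(ler_pM2r r20); clear -h1 h2; lra.
have xd' : 'D_1 x t = - (xi + y) by rewrite inclusion opprK.
move: lower; rewrite xd' !dotpE -enorm_sqr => lower.
have := dotp_le_enorm xi (- y); rewrite enormN dotpNr => cs.
have [->|xi0] := eqVneq (enorm xi) 0.
  by rewrite addr_ge0 ?enorm_ge0.
have xip : 0 < enorm xi by rewrite lt_neqAle eq_sym xi0 enorm_ge0.
by rewrite -(ler_pM2l xip); clear -lower cs; lra.
Qed.

Lemma continuous_of_abs_continuous x :
  (forall a b, a <= b -> abs_continuous a b x) -> continuous x.
Proof.
move=> ac t; apply/cvgrPdist_lt => e e0.
have [|d d0 hd] := ac (t - 1) (t + 1) _ e e0; first by lra.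
have small u v : t - 1 <= u -> u <= v -> v <= t + 1 -> v - u < d ->
    enorm (x v - x u) < e.
  move=> tu uv vt vud.
  have := hd 1%N (fun=> u) (fun=> v); rewrite !big_ord1; apply => //.
  by move=> i j _ _ _; rewrite !ord1.
near=> u.
apply: le_lt_trans (norm_le_enorm _) _.
have ud : `|t - u| < Num.min d 1.
  near: u; apply/nbhs_ballP; exists (Num.min d 1) => [|v] //=.
  by rewrite lt_min d0 ltr01.
move: ud; rewrite lt_min => /andP[ud u1].
have [ut|tu] := leP u t.
  move: ud u1; rewrite ger0_norm ?subr_ge0// => ud u1.
  by apply: small => //; clear -ut u1; lra.
rewrite enormB; move: ud u1; rewrite ltr0_norm ?subr_lt0// opprB => ud u1.
by apply: small; rewrite ?(ltW tu)//; clear -tu u1; lra.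
Unshelve. all: by end_near. Qed.

(* Near the supremum V would be forced to grow backwards in time. *)
Lemma bounded_dissipation (V : R -> R) (la be c : R) : 0 < la -> 0 <= be ->
  (forall t, 0 <= V t <= c) ->
  (forall a b k, a <= b ->
     (forall t, a <= t <= b -> be - la * V t <= k) -> V b - V a <= k * (b - a)) ->
  forall t, la * V t <= be.
Proof.
move=> la0 be0 Vc decr t; rewrite leNgt; apply/negP => Vt.
have ubV : has_ubound (range V) by exists c => _ [u _ <-]; have /andP[] := Vc u.
have supV : has_sup (range V) by split=> //; exists (V t); exists t.
set m := sup (range V).
have Vm u : V u <= m by apply: ub_le_sup => //; exists u.
pose d := (la * m - be) / 2.
have d0 : 0 < d.
  have : la * V t <= la * m by rewrite ler_pM2l.
  by rewrite /d; lra.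
have lb1 : 0 < la * be + 1 by rewrite ltr_wpDl// mulr_ge0// ltW.
(* A backward window so short that the possible loss [be * h] of [V] costs at most [d / 2] after
   multiplication by [la]; the [+ 1] allows [be = 0]. *)
pose h := d / (la * be + 1) / 2.
have h0 : 0 < h by apply: divr_gt0 => //; exact: divr_gt0.
have hd : la * be * h <= d / 2.
  rewrite /h mulrA ler_pM2r ?invr_gt0// mulrA ler_pdivrMr// mulrC.
  by rewrite ler_pM2l// lerDl.
(* The first bound on [eta] keeps the rate below [- d] on the whole window; the second makes the
   resulting gain [d * h] push [V (t1 - h)] above the supremum. *)
have eta0 : 0 < Num.min (d / la / 2) (d * h).
  rewrite lt_min (mulr_gt0 d0 h0) andbT.
  by apply: divr_gt0 => //; exact: divr_gt0.
have [_ [t1 _ <-]] := sup_adherent eta0 supV.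
rewrite -/m ltrBlDr; set eta := Num.min _ _ => mV.
have etah : eta <= d * h by rewrite ge_min lexx orbT.
have etad : la * eta <= d / 2.
  have : eta <= d / la / 2 by rewrite ge_min lexx.
  by rewrite mulrAC ler_pdivlMr// mulrC.
(* As [V] is nonnegative, its growth rate never exceeds [be]. *)
have near_t1 u : t1 - h <= u <= t1 -> V t1 - be * h <= V u.
  move=> /andP[hu ut]; have := decr u t1 be ut.
  have : be * (t1 - u) <= be * h by rewrite ler_wpM2l//; lra.
  suff pos v : be - la * V v <= be by move=> h1 /(_ (fun v _ => pos v)); lra.
  by have /andP[V0 _] := Vc v; rewrite gerBl mulr_ge0// ltW.
have := decr (t1 - h) t1 (- d) (ltac:(lra)).
have key u : t1 - h <= u <= t1 -> be - la * V u <= - d.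
  move=> /near_t1; rewrite -(ler_pM2l la0) => h1.
  have : la * m < la * (V t1 + eta) by rewrite ltr_pM2l.
  by rewrite /d in etad hd *; lra.
move=> /(_ key); have := Vm (t1 - h); lra.
Qed.


End SweepingProcess.

(** * Comparison of a solution with its time translates *)

Section ShiftedSolution.
Context {R : realType} {n : nat}.
Implicit Types (x : R -> 'rV[R]_n) (C : R -> set 'rV[R]_n).

Lemma small_on_short_shift (a b s : R) (w : R -> R -> R) :
  small_on_short (a + s) (b + s) w ->
  small_on_short a b (fun u v => w (u + s) (v + s)).
Proof.
move=> h e e0; have [d d0 {}h] := h _ e0; exists d => // m u v uv tuv sd.
apply: h => [i||]; first by have := uv i; rewrite !lerD2r.
  move=> i j _ _ [y [/= yi yj]]; apply: tuv => //; exists (y - s); split=> /=.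
    by move: yi; rewrite !in_itv/= ltrBrDr ltrBlDr.
  by move: yj; rewrite !in_itv/= ltrBrDr ltrBlDr.
by under eq_bigr do rewrite opprD addrACA subrr addr0.
Qed.

Lemma is_derive_translate x (t s : R) : derivable x (t + s) 1 ->
  is_derive t 1 (fun u => x (u + s)) ('D_1 x (t + s)).
Proof.
move=> xd.
have quotE :
    (fun h : R =>
      h^-1 *: (((fun u => x (u + s)) \o shift t) (h *: 1) - x (t + s))) =
    (fun h => h^-1 *: ((x \o shift (t + s)) (h *: 1) - x (t + s))).
  by apply/funext => h /=; rewrite addrA.
by split; rewrite /derivable /derive quotE.
Qed.

(** The pointwise algebra at one time: indices 1 and 2 refer to the solution and its translate, and
    [f12] is the original field at the translated point. The points [c1], [c2] are needed since each
    normal vector can only be tested against its own set. *)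
Lemma dissipation_estimate (x1 x2 xi1 xi2 f1 f12 f2 D1 D2 c1 c2 : 'rV[R]_n)
    (al de K L : R) : 0 <= de ->
  xi1 + f1 = - D1 -> xi2 + f2 = - D2 ->
  al * enorm (x2 - x1) ^+ 2 <= dotp (f12 - f1) (x2 - x1) ->
  enorm (f2 - f12) <= de ->
  enorm (x2 - c1) <= de -> dotp xi1 (c1 - x1) <= 0 ->
  enorm (x1 - c2) <= de -> dotp xi2 (c2 - x2) <= 0 ->
  enorm xi1 <= K -> enorm xi2 <= K -> enorm (x2 - x1) <= L ->
  dotp (x2 - x1) (D2 - D1) <= - (al * enorm (x2 - x1) ^+ 2) + de * (K + K + L).
Proof.
move=> de0 /esym/(canRL opprK)-> /esym/(canRL opprK)->.
move=> mono fde xc1 n1 xc2 n2 K1 K2 xL.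
have cs (u v : 'rV[R]_n) k : enorm u <= k -> enorm v <= de -> dotp u v <= k * de.
  move=> uk vde; apply: le_trans (dotp_le_enorm _ _) _.
  by apply: ler_pM; rewrite ?enorm_ge0.
have h1 := cs _ _ _ K1 xc1; have h2 := cs _ _ _ K2 xc2.
have h3 : dotp (x2 - x1) (- (f2 - f12)) <= L * de by apply: cs; rewrite ?enormN.
(* Routing through [c1] and [c2] splits each normal term into a part of favourable sign and an error
   of order [de]; routing through [f12] isolates the monotone part. *)
have -> : dotp (x2 - x1) (- (xi2 + f2) - - (xi1 + f1)) =
    dotp xi1 (c1 - x1) + dotp xi1 (x2 - c1) + dotp xi2 (c2 - x2)
    + dotp xi2 (x1 - c2) + dotp (x2 - x1) (- (f2 - f12))
    - dotp (f12 - f1) (x2 - x1).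
  by rewrite !(dotpC (x2 - x1)) !dotpE; ring.
lra.
Qed.

Lemma sweeping_shift_bound (f : R -> 'rV[R]_n -> 'rV[R]_n) C x
    (alpha LC M K de s : R) :
  0 < alpha -> 0 <= LC -> 0 < M -> 0 <= K -> 0 <= de ->
  (forall (t : R) (x1 x2 : 'rV[R]_n),
     dotp (f t x1 - f t x2) (x1 - x2) >= alpha * enorm (x1 - x2) ^+ 2) ->
  (forall t1 t2, (hausdorff_dist (C t1) (C t2) <= (LC * `|t1 - t2|)%:E)%E) ->
  (forall t c, C t c -> enorm c <= M) ->
  (forall t y, enorm y <= M -> enorm (f t y) <= K) ->
  (forall t y, enorm y <= M -> enorm (f (t + s) y - f t y) <= de) ->
  (forall t, excess_lt de (C (t + s)) (C t) /\ excess_lt de (C t) (C (t + s))) ->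
  sweeping_solution `]-oo, +oo[ f C x ->
  forall t, 2 * alpha * enorm (x (t + s) - x t) ^+ 2 <=
    2 * (de * (LC + K + (LC + K) + (M + M))).
Proof.
move=> al0 LC0 M0 K0 de0 mono Clip CM fK fs Cs [ac xC' sol].
have xC t : C t (x t) by apply: xC'; rewrite in_itv.
have xM t : enorm (x t) <= M by exact: CM (xC t).
pose z t := x (t + s) - x t.
have zM t : enorm (z t) <= M + M.
  by rewrite (le_trans (enormD _ _))// enormN lerD.
pose V t := enorm (z t) ^+ 2.
pose good t := derivable x t 1 /\
  [set xi + f t (x t) | xi in normal_cone (C t) (x t)] (- 'D_1 x t).
pose N : set R := [set t | ~ good t].
have N0 : lebesgue_measure.-negligible N.
  by apply: negligibleS sol => t /= ngood h; apply: ngood; apply: h; rewrite in_itv.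
(* Differentiating [z] at [t] needs both [t] and [t + s] to be good. *)
have N20 := negligibleU N0 (negligible_shift s N0).
have goodV t : good t -> good (t + s) -> exists dz,
    [/\ is_derive t 1 z dz &
      dotp (z t) dz <= - (alpha * V t) + de * (LC + K + (LC + K) + (M + M))].
  move=> [d1 [xi1 nc1 e1]] [d2 [xi2 nc2 e2]].
  have dx1 := derivableP d1; have dx2 := is_derive_translate d2.
  exists ('D_1 x (t + s) - 'D_1 x t); split; first exact: is_deriveB.
  have [Cs1 Cs2] := Cs t.
  have [c1 Cc1 xc1] := Cs1 _ (xC (t + s)); have [c2 Cc2 xc2] := Cs2 _ (xC t).
  apply: (dissipation_estimate de0 e1 e2 (mono t _ _) (fs t _ (xM _))
    (ltW xc1) (nc1.2 _ Cc1) (ltW xc2) (nc2.2 _ Cc2) _ _ (zM t)).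
    apply: le_trans (normal_component_bound LC0 Clip xC d1 nc1 e1) _.
    by rewrite lerD2l fK.
  apply: le_trans (normal_component_bound LC0 Clip xC d2 nc2 e2) _.
  by rewrite lerD2l fK.
have be0 : 0 <= 2 * (de * (LC + K + (LC + K) + (M + M))).
  by rewrite !mulr_ge0// !addr_ge0// ltW.
have V_ge0_le t : 0 <= V t <= (M + M) ^+ 2.
  have MM0 : 0 <= M + M by rewrite addr_ge0 ?(ltW M0).
  by rewrite sqr_ge0 /V ler_pXn2r ?nnegrE ?enorm_ge0 ?zM.
have al20 : 0 < 2 * alpha by rewrite mulr_gt0.
apply: (@bounded_dissipation R V (2 * alpha) _ _ al20 be0 V_ge0_le).
move=> a b k ab hk.
(* [V v - V u] factors as a difference of norms times their sum, and the sum is at most [4 * M]. *)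
have M40 : 0 < 4 * M by rewrite mulr_gt0.
have acx c d : c <= d -> small_on_short c d (fun u v => enorm (x v - x u)).
  by move=> cd; apply: ac => // t _ /=; rewrite in_itv.
have acxs : small_on_short a b (fun u v => enorm (x (v + s) - x (u + s))).
  apply: (@small_on_short_shift a b s (fun u v => enorm (x v - x u))).
  by apply: acx; rewrite lerD2r.
have acs := small_on_shortZ M40 (small_on_shortD acxs (acx _ _ ab)).
apply: (ac_increment_le ab acs _ N20).
  move=> u v _ _ _ /=.
  have h1 : enorm (z v) - enorm (z u) <=
      enorm (x (v + s) - x (u + s)) + enorm (x v - x u).
    rewrite lerBlDr; apply: (@le_trans _ _ (enorm (z v - z u) + enorm (z u))).
      by rewrite -{1}(subrK (z u) (z v)) enormD.
    rewrite lerD2r (_ : z v - z u = x (v + s) - x (u + s) - (x v - x u)).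
      by rewrite (le_trans (enormD _ _))// enormN.
    by rewrite /z !opprB addrACA [RHS]addrACA (addrC (- x v)).
  have h2 := enorm_ge0 (z u); have h3 := enorm_ge0 (z v).
  have h4 : V v - V u =
      (enorm (z v) - enorm (z u)) * (enorm (z v) + enorm (z u)).
    by rewrite /V; ring.
  rewrite h4 mulrC.
  apply: (@le_trans _ _ ((enorm (z v) + enorm (z u)) *
    (enorm (x (v + s) - x (u + s)) + enorm (x v - x u)))).
    by apply: ler_wpM2l h1; exact: addr_ge0.
  rewrite ler_wpM2r ?addr_ge0 ?enorm_ge0//.
  by have := zM u; have := zM v; lra.
move=> t e tab nN e0.
have [g1 g2] : good t /\ good (t + s).
  by split; apply: contrapT => ng; apply: nN; [left|right].
have [dz [zd dzle]] := goodV t g1 g2.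
have VE : V = fun u => dotp (z u) (z u) by apply/funext => u; rewrite /V enorm_sqr.
have zd' : derivable z t 1 by [].
have [Vd VD] := derivable_dotp zd' zd'.
rewrite VE; apply: (derive_straddle Vd _ e0).
by rewrite VD (derive_val (is_derive := zd)); have := hk t tab; lra.
Qed.

End ShiftedSolution.

(** * Uniform bounds and common almost periods of the data *)

Section AlmostPeriodicData.
Context {R : realType} {n : nat}.
Context (f : R -> 'rV[R]_n -> 'rV[R]_n) (Lf M : R) (Lf_gt0 : 0 < Lf)
  (f_lip : forall (t1 t2 : R) (x1 x2 : 'rV[R]_n),
    enorm (f t1 x1 - f t2 x2) <= Lf * `|t1 - t2| + Lf * enorm (x1 - x2))
  (f_ap : forall x : 'rV[R]_n, almost_periodic (fun t : R => f t x)).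

Let f_lip_time (y : 'rV[R]_n) (t1 t2 : R) :
  enorm (f t1 y - f t2 y) <= Lf * `|t1 - t2|.
Proof.
have := f_lip t1 t2 y y; rewrite subrr.
by rewrite enorm0 mulr0 addr0.
Qed.

Let f_lip_space (t : R) (y1 y2 : 'rV[R]_n) :
  enorm (f t y1 - f t y2) <= Lf * enorm (y1 - y2).
Proof. by have := f_lip t t y1 y2; rewrite subrr normr0 mulr0 add0r. Qed.

(** An almost period of [f] at the origin moves any time into the interval from [0] to [p], where
    the Lipschitz bound compares with [f 0 0]; [Lf * M] accounts for replacing [y] by [0]. *)
Lemma perturbation_bounded : 0 <= M ->
  exists2 K, 0 <= K & forall t y, enorm y <= M -> enorm (f t y) <= K.
Proof.
move=> M0; have [_ _ dense] := fun_period_system Lf_gt0 (f_lip_time 0) (f_ap 0).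
have [p p0 hp] := dense 1 ltr01.
exists (Lf * M + 1 + Lf * p + enorm (f 0 0)).
  by rewrite !addr_ge0 ?mulr_ge0 ?enorm_ge0// ltW.
move=> t y yM; have [s st hs] := hp (- t).
have h1 : enorm (f t y - f t 0) <= Lf * M.
  by apply: le_trans (f_lip_space _ _ _) _; rewrite subr0 ler_wpM2l// ltW.
have h2 : enorm (f (t + s) 0 - f 0 0) <= Lf * p.
  apply: le_trans (f_lip_time _ _ _) _; rewrite subr0 ler_wpM2l ?(ltW Lf_gt0)//.
  by rewrite ger0_norm; lra.
have h3 := hs t; rewrite enormB in h3.
have h4 := enormD (f t y - f t 0) (f t 0).
have h5 := enormD (f t 0 - f (t + s) 0) (f (t + s) 0).
have h6 := enormD (f (t + s) 0 - f 0 0) (f 0 0).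
rewrite !subrK in h4 h5 h6; clear -h1 h2 h3 h4 h5 h6; lra.
Qed.

Lemma uniform_almost_periods (C : R -> set 'rV[R]_n) (LC de : R) : 0 < LC ->
  (forall t1 t2, (hausdorff_dist (C t1) (C t2) <= (LC * `|t1 - t2|)%:E)%E) ->
  almost_periodic_set C -> 0 < de ->
  exists2 p, 0 < p & forall a, exists2 s, a < s < a + p &
    (forall t y, enorm y <= M -> enorm (f (t + s) y - f t y) <= de) /\
    (forall t, excess_lt de (C (t + s)) (C t) /\ excess_lt de (C t) (C (t + s))).
Proof.
move=> LC0 Clip Cap de0.
have psC := set_period_system LC0 Clip Cap.
(* Moving to a net point at time [t + s] and back at time [t] costs [de / 4] each, the almost period
   another [de / 4]. *)
have r0 : 0 < de / 4 / Lf by rewrite !divr_gt0.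
have [l hl] := @enorm_ball_net R n M _ r0.
have psf := period_system_seq l
  (fun y => fun_period_system Lf_gt0 (f_lip_time y) (f_ap y)).
have [_ _ dense] := period_systemI psf psC.
have [|p p0 hp] := dense (de / 4); first by rewrite divr_gt0.
exists p => // a; have [s sa [sf sC]] := hp a; exists s => //; split; last first.
  by apply: period_system_weaken psC _ sC; lra.
move=> t y /hl[y' y'l yy'].
have near_f u : enorm (f u y - f u y') <= de / 4.
  apply: le_trans (f_lip_space _ _ _) _.
  by rewrite mulrC -ler_pdivlMr// ltW.
have h1 := near_f (t + s); have h2 := near_f t; rewrite enormB in h2.
have h3 := sf y' y'l t.
have h4 := enorm_triangle (f (t + s) y') (f (t + s) y) (f t y).
have h5 := enorm_triangle (f t y') (f (t + s) y') (f t y).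
lra.
Qed.

End AlmostPeriodicData.

Unset Implicit Arguments.

Theorem theorem3p1 (R : realType) (n : nat)
    (f : R -> 'rV[R]_n -> 'rV[R]_n) (C : R -> set 'rV[R]_n)
    (Lf : R) (Lf_gt0 : 0 < Lf)
    (f_lip : forall (t1 t2 : R) (x1 x2 : 'rV[R]_n),
       enorm (f t1 x1 - f t2 x2) <= Lf * `|t1 - t2| + Lf * enorm (x1 - x2))
    (alpha : R) (alpha_gt0 : 0 < alpha)
    (f_mono : forall (t : R) (x1 x2 : 'rV[R]_n),
       dotp (f t x1 - f t x2) (x1 - x2) >= alpha * enorm (x1 - x2) ^+ 2)
    (C_nonempty : forall t : R, C t !=set0)
    (C_closed : forall t : R, closed (C t))
    (C_convex : forall t : R, convex_set (C t))
    (LC : R) (LC_gt0 : 0 < LC)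
    (C_lip : forall t1 t2 : R,
       (hausdorff_dist (C t1) (C t2) <= (LC * `|t1 - t2|)%:E)%E)
    (M : R) (M_gt0 : 0 < M)
    (C_bounded : forall (t : R) (c : 'rV[R]_n), C t c -> enorm c <= M)
    (x0 : R -> 'rV[R]_n)
    (x0_sol : sweeping_solution `]-oo, +oo[ f C x0)
    (f_ap : forall x : 'rV[R]_n, almost_periodic (fun t : R => f t x))
    (C_ap : almost_periodic_set C) :
  almost_periodic x0.
Proof.
have [ac _ _] := x0_sol.
have [K K0 fK] := perturbation_bounded Lf_gt0 f_lip f_ap (ltW M_gt0).
split.
  apply: continuous_of_abs_continuous => a b ab.
  by apply: ac => // t _ /=; rewrite in_itv.
move=> e e0; pose B := LC + K + (LC + K) + (M + M).
have B0 : 0 < B by rewrite /B; lra.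
(* With this tolerance the shift bound reads [2 * alpha * V <= alpha * e ^+ 2] for the squared
   distance [V], so [V] is at most half of [e ^+ 2], which gives the strict inequality. *)
have de0 : 0 < alpha * e ^+ 2 / (2 * B) by rewrite divr_gt0 ?mulr_gt0 ?exprn_gt0.
have [p p0 hp] :=
  uniform_almost_periods M Lf_gt0 f_lip f_ap LC_gt0 C_lip C_ap de0.
exists p => // a; have [s sa [sf sC]] := hp a; exists s.
  by rewrite in_itv.
move=> t; rewrite lte_fin -(ltr_pXn2r (n := 2)) ?nnegrE ?enorm_ge0 ?ltW//.
have := sweeping_shift_bound alpha_gt0 (ltW LC_gt0) M_gt0 K0 (ltW de0) f_mono
  C_lip C_bounded fK sf sC x0_sol t.
rewrite -/B (_ : _ / _ * B = alpha * (e ^+ 2 / 2)); last first.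
  by field; rewrite gt_eqF.
rewrite mulrA ler_pM2l ?mulr_gt0// => /le_lt_trans; apply.
by rewrite ltr_pdivrMr// ltr_pMr ?exprn_gt0// ltr1n.
Qed.
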